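(* Let $X$ be a continuous random variable with cdf $F_X$, pdf $f_X$ and support $S_X$. The following two statements are equivalent for any $F_X\in\mathbb{C}$: (i) the random variable $X$ has a symmetric distribution; (ii) $G\bar\xi_m(J(X))=G\xi_m(J(X))$ for a given fixed number $m\ge1$.
   Context: $F_X^{-1}$ denotes the inverse function of $F_X$, and $\bar F_X=1-F_X$. Symmetric: $X$ has a symmetric distribution if there is a finite real number $c$ such that $f_X(c+x)=f_X(c-x)$, that is, $F_X(c-x)+F_X(c+x)=1$, for all real $x$. Class $\mathbb{C}$: the class of all continuous pdfs $f_X$, with cdf $F_X$, such that either $f_X(F_X^{-1}(1-u))\ge f_X(F_X^{-1}(u))$ for all $u\in(0,\tfrac12)$, or $f_X(F_X^{-1}(1-u))\le f_X(F_X^{-1}(u))$ for all $u\in(0,\tfrac12)$; $F_X\in\mathbb{C}$ means that the distribution with cdf $F_X$ belongs to this class. Generalized cumulative past extropy: $G\bar\xi_m(J(X))=-\frac12\int_{S_X}F_X^m(x)\,dx=-\frac12\int_0^1\frac{u^m}{f_X(F_X^{-1}(u))}\,du$. Generalized cumulative residual extropy: $G\xi_m(J(X))=-\frac12\int_{S_X}\bar F_X^m(x)\,dx=-\frac12\int_0^1\frac{u^m}{f_X(F_X^{-1}(1-u))}\,du$.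
   Formalization: At least one of the two extropies is assumed finite: otherwise (ii) reads −∞ = −∞ and fails to give symmetry (e.g. the Gumbel law, which is in ℂ). F_X is taken invertible on levels in (0,1) and f_X > 0 a.e. on S_X, as the inverse and the two extropy formulas presuppose. *)

(* Defs.v *)
From HB Require Import structures.
From mathcomp Require Import all_boot all_order all_algebra.
From mathcomp Require Import all_classical all_reals all_analysis.
Import Order.TTheory GRing.Theory Num.Theory.
Import numFieldNormedType.Exports.

Set Implicit Arguments.
Unset Strict Implicit.
Unset Printing Implicit Defensive.

Local Open Scope classical_set_scope.
Local Open Scope ring_scope.

Section generalized_cumulative_extropy.
Context (d : measure_display) (T : measurableType d) (R : realType).
Context (P : probability T R) (X : {RV P >-> R}).

Let mu : {measure set (measurableTypeR R) -> \bar R} := @lebesgue_measure R.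

Definition is_pdf (f : R -> R) : Prop :=
  [/\ measurable_fun setT f,
      (forall x, 0 <= f x) &
      forall A : set R, measurable A ->
        distribution P X A = (\int[mu]_(x in A) (f x)%:E)%E].

(* [cdf X] is extended-real valued in the library. *)
Definition rcdf (x : R) : R := fine (cdf X x).

(* The points all of whose neighbourhoods have positive probability. The
   intervals are half-open, which is immaterial for a continuous law. *)
Definition law_support : set R :=
  [set x | forall e, 0 < e -> rcdf (x - e) < rcdf (x + e)].

(* The levels 0 and 1 are discarded: only they can be reached outside the
   interior of the support when the law is continuous and cdf_invertible. *)
Definition cdf_dom : set R := [set x | 0 < rcdf x < 1].

Definition cdf_invertible : Prop := {in cdf_dom &, injective rcdf}.

Definition cdf_inv : R -> R := pinv cdf_dom rcdf.

Definition symmetric_law : Prop :=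
  exists c : R, forall x : R, rcdf (c - x) + rcdf (c + x) = 1.

(* Continuity is required only inside the support, so that densities jumping
   at its end-points (the uniform law, for instance) are covered. *)
Definition class_C (f : R -> R) : Prop :=
  (forall x, interior law_support x -> {for x, continuous f}) /\
  ((forall u, 0 < u < 2^-1 -> f (cdf_inv (1 - u)) >= f (cdf_inv u)) \/
   (forall u, 0 < u < 2^-1 -> f (cdf_inv (1 - u)) <= f (cdf_inv u))).

(* Both quantities may be -oo. *)
Definition gen_cumulative_past_extropy (m : R) : \bar R :=
  ((- 2^-1)%:E * \int[mu]_(x in law_support) (rcdf x `^ m)%:E)%E.

Definition gen_cumulative_residual_extropy (m : R) : \bar R :=
  ((- 2^-1)%:E * \int[mu]_(x in law_support) ((1 - rcdf x) `^ m)%:E)%E.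

End generalized_cumulative_extropy.

(* Main.v *)
Require Import Defs.
From HB Require Import structures.
From mathcomp Require Import all_boot all_order all_algebra.
From mathcomp Require Import all_classical all_reals all_analysis.
From mathcomp Require Import measurable_realfun.
From mathcomp Require Import ring lra.
Import Order.TTheory GRing.Theory Num.Theory.
Import numFieldNormedType.Exports.

Set Implicit Arguments.
Unset Strict Implicit.
Unset Printing Implicit Defensive.

Local Open Scope classical_set_scope.
Local Open Scope ring_scope.

(** Why the equivalence holds. Write F for the distribution function and S for
the support. If the law is symmetric about c, the map x |-> 2c - x preserves
Lebesgue measure and S and exchanges F and 1 - F, so it exchanges the two
integrals.

For the converse, a finite extropy bounds the support on one side and the
equality bounds it on the other: S = [a, b], with F increasing from 0 to 1. Let
psi be the level reflection of [a, b], determined by F (psi x) = 1 - F x. It is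
a decreasing involution that preserves the law of X, because F(X) and 1 - F(X)
are both uniform. On quantiles psi maps F^-1(u) to F^-1(1 - u), so membership
in the class says that f and f o psi are ordered, in the same direction on the
whole lower half of the law. A law-preserving map spreads mass where it lowers
the density: if f <= f o psi on an interval I, then psi I is not longer than I
[lebesgue_le_preimage_of_law_preserving]. This replaces the change of variables
dx = du / f(F^-1(u)), which is delicate where f vanishes inside S. Applied to the intervals that share an end with [a, b], it
puts psi x on one side of a + b - x for all x simultaneously, hence F x on one
side of 1 - F (a + b - x) [class_C_cdf_reflection].

The reflection x |-> a + b - x turns the residual integral into the integral
over [a, b] of (1 - F (a + b - x))^m, whose integrand is thus ordered with
respect to F^m. Equality of the integrals makes the integrands equal almost
everywhere, hence everywhere by continuity, and the law is symmetric about
(a + b) / 2. *)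

(** * Lebesgue measure, reflections and densities *)

Section reflection.
Context (R : realType).
Let mu : {measure set (measurableTypeR R) -> \bar R} := @lebesgue_measure R.

Lemma measurable_reflect (c : R) :
  measurable_fun setT
    ((fun x => c - x) : measurableTypeR R -> measurableTypeR R).
Proof.
by apply: nonincreasing_measurable => // x y; rewrite lerD2l lerN2.
Qed.

Lemma lebesgue_measure_reflect (c : R) (A : set R) : measurable A ->
  pushforward mu ((fun x => c - x) : measurableTypeR R -> measurableTypeR R) A =
  mu A.
Proof.
have mr := measurable_reflect c.
pose rm : {mfun measurableTypeR R >-> measurableTypeR R} :=
  HB.pack ((fun x => c - x) : measurableTypeR R -> measurableTypeR R)
    (isMeasurableFun.Build _ _ _ _ _ mr).
move=> mA; apply/esym.
apply: (@lebesgue_measure_unique R (pushforward mu rm)) => //= _ [[a b]] _ <-.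
rewrite /pushforward /=.
have -> : (fun x => c - x) @^-1` `]a, b]%classic = `[c - b, c - a[%classic.
  apply/seteqP; split=> x; rewrite /= !in_itv/= => /andP[h1 h2];
    by apply/andP; split; lra.
rewrite [mu _]lebesgue_measure_itv lebesgue_measure_itv /= !lte_fin.
have -> : (c - b < c - a) = (a < b) by apply/idP/idP; lra.
by case: ifP => // _; rewrite -!EFinB; congr EFin; lra.
Qed.

Lemma ge0_integral_reflect (c : R) (D : set R) (g : R -> \bar R) :
  measurable D -> measurable_fun D g -> (forall x, D x -> (0 <= g x)%E) ->
  (\int[mu]_(x in D) g x =
   \int[mu]_(x in (fun x => c - x)%R @^-1` D) g (c - x)%R)%E.
Proof.
move=> mD mg g0.
have mr := measurable_reflect c.
rewrite -(@ge0_integral_pushforward _ _ _ _ _ _ mr mu D g) //; last first.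
  by move=> y /set_mem; exact: g0.
apply: eq_measure_integral => A mA _; exact/esym/lebesgue_measure_reflect.
Qed.

End reflection.

Section density.
Context (R : realType) (f : R -> R).
Let mu : {measure set (measurableTypeR R) -> \bar R} := @lebesgue_measure R.
Context (nu : {finite_measure set (measurableTypeR R) -> \bar R}).
Hypothesis f_meas : measurable_fun setT f.
Hypothesis f_ge0 : forall x, 0 <= f x.
Hypothesis f_density :
  forall A : set R, measurable A -> nu A = (\int[mu]_(x in A) (f x)%:E)%E.

Lemma density_integrable : mu.-integrable setT (EFin \o f).
Proof.
apply/integrableP; split; first exact/measurable_EFinP.
under eq_integral do rewrite /= ger0_norm//.
by rewrite -f_density// ltey_eq fin_num_measure.
Qed.

(** The Radon-Nikodym derivative agrees almost everywhere with any density, so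
its change of variables transfers to a density given in advance. *)
Lemma ge0_integral_density (D : set R) (g : R -> R) :
  measurable D -> measurable_fun setT g -> (forall x, 0 <= g x) ->
  (\int[nu]_(x in D) (g x)%:E = \int[mu]_(x in D) (g x * f x)%:E)%E.
Proof.
move=> mD mg g0.
have dom : nu `<< (@lebesgue_measure R).
  apply/null_content_dominatesP => A mA A0; rewrite f_density//.
  apply: null_set_integral => //.
  by apply/measurable_EFinP; exact: measurable_funTS.
have rn := @Radon_Nikodym_SigmaFinite.change_of_variables
  _ _ R nu (@lebesgue_measure R) dom (EFin \o g) D.
rewrite -rn; last 3 first.
- by move=> x; rewrite lee_fin.
- by [].
- by apply/measurable_EFinP; exact: measurable_funTS.
have iRN := Radon_Nikodym_SigmaFinite.f_integrable dom.
apply: ge0_ae_eq_integral => //.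
- apply: emeasurable_funM; first by apply/measurable_EFinP; exact: measurable_funTS.
  by apply: measurable_funTS; exact: measurable_int iRN.
- by apply/measurable_EFinP/measurable_funTS/measurable_funM.
- move=> x _; apply: mule_ge0; first by rewrite lee_fin.
  exact: Radon_Nikodym_SigmaFinite.f_ge0.
- by move=> x _; rewrite lee_fin mulr_ge0.
under [X in ae_eq _ _ _ X]eq_fun do rewrite EFinM.
apply: ae_eqe_mul2l.
apply: integral_ae_eq => //.
- exact: (integrableS measurableT).
- by apply/measurable_EFinP; exact: measurable_funTS.
by move=> A AD mA; rewrite -Radon_Nikodym_SigmaFinite.f_integral// f_density.
Qed.

(** The length of B is the integral of 1/f against nu over B. As nu is
psi-invariant, this is the integral of 1/(f o psi) against nu over the preimage,
that is, the integral of the ratio f/(f o psi) <= 1 against Lebesgue measure. *)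
Lemma lebesgue_le_preimage_of_law_preserving (psi : R -> R) (B : set R) :
  measurable_fun setT (psi : measurableTypeR R -> measurableTypeR R) ->
  (forall A : set R, measurable A -> nu (psi @^-1` A) = nu A) ->
  measurable B ->
  {ae mu, forall x, B x -> 0 < f x} ->
  (forall x, B (psi x) -> f x <= f (psi x)) ->
  (mu B <= mu (psi @^-1` B))%E.
Proof.
move=> mpsi psiP mB f_pos f_le.
have mpB : measurable (psi @^-1` B).
  by rewrite -[X in measurable X]setTI; exact: mpsi.
have mfV : measurable_fun setT (fun x => (f x)^-1).
  (* The convention 0^-1 = 0 also holds for powR. *)
  rewrite (_ : (fun x => _) = (@powR R ^~ (- 1)) \o f).
    by apply: measurableT_comp => //; exact: measurable_powR.
  by apply/funext => x /=; rewrite powR_inv1.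
have -> : mu B = (\int[mu]_(x in B) ((f x)^-1 * f x)%:E)%E.
  rewrite -[LHS]mul1e -integral_cst//; apply: ge0_ae_eq_integral => //.
  - by apply/measurable_EFinP/measurable_funTS/measurable_funM.
  - by move=> x _; rewrite lee_fin mulr_ge0// invr_ge0.
  case: f_pos => N [mN N0 posN]; exists N; split=> //.
  apply: subset_trans posN; apply: subsetC => x /= fx Bx.
  by rewrite mulVf// gt_eqF//; exact: fx.
rewrite -ge0_integral_density//; last by move=> x; rewrite invr_ge0.
have -> : (\int[nu]_(x in B) (f x)^-1%:E =
    \int[nu]_(x in psi @^-1` B) (f (psi x))^-1%:E)%E.
  rewrite -(@ge0_integral_pushforward _ _ _ _ _ _ mpsi nu B
    (fun x => ((f x)^-1)%:E)) //.
  + by apply: eq_measure_integral => A mA _; exact/esym/psiP.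
  + by apply/measurable_EFinP/measurable_funTS.
  + by move=> y _; rewrite lee_fin invr_ge0.
rewrite (@ge0_integral_density _ (fun x => (f (psi x))^-1))//; last 2 first.
- exact: (measurableT_comp mfV mpsi).
- by move=> x; rewrite invr_ge0.
rewrite -[leRHS]mul1e -integral_cst//; apply: ge0_le_integral => //.
- by move=> x _; rewrite lee_fin mulr_ge0// invr_ge0.
- apply/measurable_EFinP/measurable_funTS/measurable_funM => //.
  exact: (measurableT_comp mfV mpsi).
move=> x Bx; rewrite lee_fin.
have [->|fn0] := eqVneq (f (psi x)) 0; first by rewrite invr0 mul0r.
by rewrite mulrC ler_pdivrMr ?lt_def ?fn0//= mul1r; exact: f_le.
Qed.

End density.

Lemma integral_ge_cst_pinfty (R : realType) (D A : set R) (g : R -> R) (k : R) :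
  measurable D -> measurable A -> A `<=` D -> measurable_fun setT g ->
  (forall x, 0 <= g x) -> 0 < k -> (forall x, A x -> k <= g x) ->
  lebesgue_measure A = +oo%E ->
  (\int[@lebesgue_measure R]_(x in D) (g x)%:E = +oo)%E.
Proof.
move=> mD mA AD mg g0 k0 kg muA; apply/eqP; rewrite -leye_eq.
have mgE B : measurable_fun B (EFin \o g).
  by apply/measurable_EFinP; exact: measurable_funTS.
apply: (@le_trans _ _ (\int[@lebesgue_measure R]_(x in A) (g x)%:E)%E); last first.
  by apply: ge0_subset_integral => //; [exact: mgE|move=> x _; rewrite lee_fin].
apply: (@le_trans _ _ (\int[@lebesgue_measure R]_(x in A) (cst k%:E x))%E).
  by rewrite integral_cst// [X in (_ * X)%E]muA gt0_muley.
apply: ge0_le_integral => //.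
- by move=> x _; rewrite lee_fin ltW.
- exact: mgE.
Qed.

(** The nonnegative difference has integral zero. *)
Lemma ae_eq_of_le_integral d (T : measurableType d) (R : realType)
    (mu : {measure set T -> \bar R}) (D : set T) (g h : T -> R) :
  measurable D -> measurable_fun D g -> measurable_fun D h ->
  (forall x, D x -> 0 <= g x <= h x) ->
  (\int[mu]_(x in D) (g x)%:E)%E \is a fin_num ->
  (\int[mu]_(x in D) (g x)%:E = \int[mu]_(x in D) (h x)%:E)%E ->
  {ae mu, forall x, D x -> g x = h x}.
Proof.
move=> mD mg mh gh gfin E.
have mgh : measurable_fun D (fun x => (h x - g x)%:E).
  by apply/measurable_EFinP; exact: measurable_funB.
have : (\int[mu]_(x in D) (h x - g x)%:E = 0)%E.
  have : (\int[mu]_(x in D) (h x)%:E =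
      \int[mu]_(x in D) (g x)%:E + \int[mu]_(x in D) (h x - g x)%:E)%E.
    rewrite -ge0_integralD//.
    - by apply: eq_integral => x _; rewrite -EFinD addrC subrK.
    - by move=> x /gh /andP[]; rewrite lee_fin.
    - by apply/measurable_EFinP.
    - by move=> x /gh /andP[_]; rewrite lee_fin subr_ge0.
  by move=> sum; rewrite -[LHS](addeK _ gfin) [X in (X - _)%E]addeC -sum -E subee.
have -> : (\int[mu]_(x in D) (h x - g x)%:E = \int[mu]_(x in D) `|(h x - g x)%:E|)%E.
  apply: eq_integral => x /set_mem /gh /andP[_ gh'].
  by rewrite gee0_abs// lee_fin subr_ge0.
move/(ae_eq_integral_abs mu mD mgh) => [N [mN N0 subN]]; exists N; split=> //.
apply: subset_trans subN; apply: subsetC => x /= H Dx.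
by have /eqP := H Dx; rewrite eqe subr_eq0 => /eqP.
Qed.

(** If g and h differed at a point of [a, b], they would differ on an interval
of positive length; a < b keeps this true at the end-points. *)
Lemma continuous_eq_of_ae (R : realType) (a b : R) (g h : R -> R) :
  a < b -> continuous g -> continuous h ->
  {ae @lebesgue_measure R, forall x, a <= x <= b -> g x = h x} ->
  forall x, a <= x <= b -> g x = h x.
Proof.
move=> ab cg ch [N [mN N0 subN]] z zab; apply: contrapT => /eqP.
rewrite -subr_eq0 => gh.
have : \forall x \near z, g x - h x != 0.
  have ck : (fun x => g x - h x) @ z --> g z - h z.
    by apply: cvgB; [exact: cg|exact: ch].
  exact: (cvgr_neq0 _ ck).
move=> [e /= e0 eP].
pose l := Num.max a (z - e); pose r := Num.min b (z + e).
have lr : l < r by rewrite /l /r gt_max !lt_min; lra.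
have sub : `]l, r[%classic `<=` N.
  apply: subset_trans subN => x /=.
  rewrite in_itv/= /l /r gt_max lt_min => /andP[/andP[ax zx] /andP[xb xz]] H.
  have /eP : ball z e x by rewrite /ball/= ltr_norml; lra.
  by rewrite /= H ?subrr ?eqxx//; lra.
have : (@lebesgue_measure R `]l, r[%classic <= lebesgue_measure N)%E.
  by apply: le_measure => //; rewrite inE//; exact: measurable_itv.
rewrite N0 lebesgue_measure_itv/= lte_fin lr -EFinB lee_fin; lra.
Qed.

(** * The distribution function and the support *)

Section cdf.
Context d (T : measurableType d) (R : realType) (P : probability T R).
Context (X : {RV P >-> R}).
Let mu : {measure set (measurableTypeR R) -> \bar R} := @lebesgue_measure R.
Local Notation F := (rcdf X).
Local Notation S := (law_support X).

Lemma rcdfK x : (F x)%:E = distribution P X `]-oo, x]%classic.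
Proof. by rewrite fineK// fin_num_measure. Qed.

Lemma rcdf_ge0 x : 0 <= F x.
Proof. exact: fine_ge0. Qed.

Lemma rcdf_le1 x : F x <= 1.
Proof. by rewrite -lee_fin rcdfK; exact: cdf_le1. Qed.

Lemma rcdf_nondecreasing : {homo F : x y / x <= y}.
Proof.
by move=> x y xy; rewrite -lee_fin !rcdfK; exact: cdf_nondecreasing.
Qed.

Lemma rcdf_measurable : measurable_fun setT F.
Proof. by apply: nondecreasing_measurable => //; exact: rcdf_nondecreasing. Qed.

Lemma distribution_itvoc x y : x <= y ->
  distribution P X `]x, y]%classic = (F y - F x)%:E.
Proof.
move=> xy; have -> : `]x, y]%classic = `]-oo, y]%classic `\` `]-oo, x]%classic.
  apply/seteqP; split=> z; rewrite /= !in_itv/=.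
    by move=> /andP[xz ->]; split=> //; rewrite leNgt xz.
  by move=> [-> /negP]; rewrite andbT -ltNge.
rewrite measureD//; last by rewrite ltey_eq fin_num_measure.
rewrite setIidr; last by apply: subset_itvl; rewrite bnd_simp.
by rewrite EFinB !rcdfK.
Qed.

Lemma distribution_itvoy r : distribution P X `]r, +oo[%classic = (1 - F r)%:E.
Proof. by have := ccdf_1_cdf X r; rewrite /ccdf => ->; rewrite EFinB rcdfK. Qed.

Lemma rcdf_gt_near1 e : e < 1 -> exists x, e < F x.
Proof.
move=> e1; have := @cvg_cdfy1 _ _ _ P X.
move=> /fine_cvg /= /cvgr_gt /(_ _ e1) [x [_ xP]].
by exists (x + 1); apply: xP; rewrite ltrDl.
Qed.

Lemma rcdf_lt_near0 e : 0 < e -> exists x, F x < e.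
Proof.
move=> e0; have := @cvg_cdfNy0 _ _ _ P X.
move=> /fine_cvg /= /cvgr_lt /(_ _ e0) [x [_ xP]].
by exists (x - 1); apply: xP; rewrite ltrBlDr ltrDl.
Qed.

Section invertible.
Hypothesis F_inv : cdf_invertible X.

Lemma cdf_dom_support x : 0 < F x < 1 -> S x.
Proof.
move=> Fx e e0; have [//|Fe] := ltP (F (x - e)) (F (x + e)).
have le1 : F (x - e) <= F x by apply: rcdf_nondecreasing; lra.
have le2 : F x <= F (x + e) by apply: rcdf_nondecreasing; lra.
have Fxe : F (x - e) = F x by lra.
have : x - e = x by apply: F_inv; rewrite ?inE /cdf_dom/= ?Fxe.
by lra.
Qed.

(** A point strictly between two points of the support has its level strictly
between 0 and 1, where injectivity forces F to increase. *)
Lemma law_support_interval : is_interval S.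
Proof.
move=> x z Sx Sz y /andP[xy yz].
have [<-//|nxy] := eqVneq x y; have [->//|nyz] := eqVneq y z.
apply: cdf_dom_support; apply/andP; split.
  have := Sx (y - x); rewrite subr_gt0 lt_neqAle nxy xy => /(_ isT).
  rewrite subrKC; apply: le_lt_trans; exact: rcdf_ge0.
have := Sz (z - y); rewrite subr_gt0 lt_neqAle nyz yz => /(_ isT).
rewrite subKr => /lt_le_trans; apply; exact: rcdf_le1.
Qed.

Lemma measurable_law_support : measurable S.
Proof. by apply: is_interval_measurable; exact: law_support_interval. Qed.

End invertible.

End cdf.

Section continuous_cdf.
Context d (T : measurableType d) (R : realType) (P : probability T R).
Context (X : {RV P >-> R}) (f : R -> R).
Local Notation F := (rcdf X).
Hypothesis f_pdf : is_pdf X f.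

Let mX : measurable_fun setT (X : T -> measurableTypeR R).
Proof.
move=> _ A mA.
have := @measurable_funPT _ _ _ _ X measurableT A.
exact.
Qed.

Let XR : {mfun T >-> measurableTypeR R} :=
  HB.pack (X : T -> measurableTypeR R) (isMeasurableFun.Build _ _ _ _ _ mX).

(** The distribution of X, on the copy of the real line that carries Lebesgue
measure, so that the two measures can be compared. *)
Definition law : {finite_measure set (measurableTypeR R) -> \bar R} :=
  distribution P XR.

Lemma lawE (A : set R) : law A = distribution P X A.
Proof. by []. Qed.

Lemma law_density (A : set R) : measurable A ->
  law A = (\int[@lebesgue_measure R]_(x in A) (f x)%:E)%E.
Proof. by case: f_pdf => _ _; exact. Qed.

(** A law with a density has no atoms. *)
Lemma distribution_itvNyo z : distribution P X `]-oo, z[%classic = (F z)%:E.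
Proof.
rewrite rcdfK; apply/esym.
have -> : `]-oo, z]%classic = `]-oo, z[%classic `|` [set z].
  apply/seteqP; split=> x /=; rewrite !in_itv/=.
    by rewrite le_eqVlt => /orP[/eqP|]; [right|left].
  by case=> [/ltW//|->]; rewrite lexx.
rewrite measureU//; last first.
  by apply/seteqP; split=> // x /= [] /[swap] ->; rewrite in_itv/= ltxx.
case: f_pdf => mf f0 fP; rewrite [X in (_ + X)%E]fP//.
rewrite null_set_integral ?adde0//; last exact: lebesgue_measure_set1.
by apply/measurable_EFinP; exact: measurable_funTS.
Qed.

(** Absolute continuity of the integral: the increments of F are integrals of f
over short intervals. *)
Lemma rcdf_continuous : continuous F.
Proof.
case: f_pdf => mf f0 fP x.
have int_f := @density_integrable _ f law mf f0 law_density.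
apply/cvgrPdist_lt => e e0.
have [r [r0 rP]] := integral_normr_continuous int_f e0.
suff close y z : y <= z -> z - y < r -> F z - F y < e.
  exists r => //= y; rewrite /ball/= => xyr.
  have [xy|/ltW yx] := leP x y.
    rewrite distrC ger0_norm; last by rewrite subr_ge0 rcdf_nondecreasing.
    by apply: close => //; rewrite distrC ger0_norm ?subr_ge0 in xyr.
  rewrite ger0_norm; last by rewrite subr_ge0 rcdf_nondecreasing.
  by apply: close => //; rewrite ger0_norm ?subr_ge0 in xyr.
move=> yz zyr.
have mI : measurable (`]y, z]%classic : set (measurableTypeR R)).
  exact: measurable_itv.
have len : (@lebesgue_measure R `]y, z]%classic < r%:E)%E.
  rewrite lebesgue_measure_itv /= lte_fin.
  by case: ifP => _; rewrite ?lte_fin.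
have := rP _ mI len; rewrite /Rintegral.
under eq_integral do rewrite ger0_norm//.
by rewrite -law_density// lawE distribution_itvoc.
Qed.

(** The zero set of F is closed, so its supremum a is a zero. *)
Lemma rcdf_bottom : (exists x, F x = 0) ->
  exists a, F a = 0 /\ forall x, a < x -> 0 < F x.
Proof.
move=> [x0 Fx0]; pose A := [set x | F x = 0].
have [x1 Fx1] := @rcdf_gt_near1 _ _ _ P X 0 ltr01.
have ubA : ubound A x1.
  move=> x Ax; rewrite leNgt; apply/negP => /ltW /(@rcdf_nondecreasing _ _ _ _ X).
  by rewrite Ax leNgt Fx1.
have supA : has_sup A by split; [exists x0|exists x1].
exists (sup A); split; last first.
  move=> x sx; rewrite lt_neqAle rcdf_ge0 andbT eq_sym; apply/eqP => Fx.
  by have := sup_upper_bound supA Fx; rewrite leNgt sx.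
have clA : closed A.
  rewrite (_ : A = F @^-1` [set 0])//; apply: closed_comp; last exact: closed_eq.
  by move=> x _; exact: rcdf_continuous.
by apply: clA; apply: closure_sup; case: supA.
Qed.

Lemma rcdf_top : (exists x, F x = 1) ->
  exists b, F b = 1 /\ forall x, x < b -> F x < 1.
Proof.
move=> [x0 Fx0]; pose A := [set x | F (- x) = 1].
have [x1 Fx1] := @rcdf_lt_near0 _ _ _ P X 1 ltr01.
have ubA : ubound A (- x1).
  move=> x Ax; rewrite leNgt; apply/negP; rewrite ltrNl => /ltW.
  by move=> /(@rcdf_nondecreasing _ _ _ _ X); rewrite Ax leNgt Fx1.
have supA : has_sup A.
  by split; [exists (- x0); rewrite /A/= opprK|exists (- x1)].
exists (- sup A); split; last first.
  move=> x sx; rewrite lt_neqAle rcdf_le1 andbT; apply/eqP => Fx.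
  have : A (- x) by rewrite /A/= opprK.
  by move/(sup_upper_bound supA); rewrite lerNl leNgt sx.
have clA : closed A.
  rewrite (_ : A = (F \o -%R) @^-1` [set 1])//; apply: closed_comp; last exact: closed_eq.
  move=> x _; apply: continuous_comp; first exact: opp_continuous.
  exact: rcdf_continuous.
by apply: clA; apply: closure_sup; case: supA.
Qed.

End continuous_cdf.

(** * The two extropy integrals *)

Section extropy.
Context d (T : measurableType d) (R : realType) (P : probability T R).
Context (X : {RV P >-> R}) (m : R).
Let mu : {measure set (measurableTypeR R) -> \bar R} := @lebesgue_measure R.
Local Notation F := (rcdf X).
Local Notation S := (law_support X).
Hypothesis F_inv : cdf_invertible X.
Hypothesis m_gt0 : 0 < m.

Definition past_integral := (\int[mu]_(x in S) (F x `^ m)%:E)%E.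
Definition residual_integral := (\int[mu]_(x in S) ((1 - F x) `^ m)%:E)%E.

Lemma past_integralE :
  past_integral = ((- 2)%:E * gen_cumulative_past_extropy X m)%E.
Proof.
rewrite /gen_cumulative_past_extropy muleA -EFinM mulrNN mulfV// ?mul1e//.
Qed.

Lemma residual_integralE :
  residual_integral = ((- 2)%:E * gen_cumulative_residual_extropy X m)%E.
Proof.
rewrite /gen_cumulative_residual_extropy muleA -EFinM mulrNN mulfV// ?mul1e//.
Qed.

Lemma extropy_eqP :
  gen_cumulative_past_extropy X m = gen_cumulative_residual_extropy X m <->
  past_integral = residual_integral.
Proof.
split=> [E|E]; first by rewrite past_integralE E -residual_integralE.
by congr (_ * _)%E.
Qed.

Lemma past_measurable : measurable_fun setT (fun x => F x `^ m).
Proof.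
apply: (measurableT_comp (@measurable_powR R m)); exact: rcdf_measurable.
Qed.

Lemma residual_measurable : measurable_fun setT (fun x => (1 - F x) `^ m).
Proof.
apply: (measurableT_comp (@measurable_powR R m)).
apply: nonincreasing_measurable => // x y xy; rewrite lerD2l lerN2.
exact: rcdf_nondecreasing.
Qed.

(** Otherwise the support contains a half-line on which F exceeds 1/2, and F^m
has infinite integral. *)
Lemma past_fin_reaches1 : past_integral \is a fin_num -> exists x, F x = 1.
Proof.
move=> fin; apply: contrapT => /forallNP F1.
have [x0 x0P] := @rcdf_gt_near1 _ _ _ P X 2^-1 ltac:(lra).
suff E : past_integral = +oo%E by rewrite E in fin.
apply: (@integral_ge_cst_pinfty R S `[x0, +oo[%classic _ (2^-1 `^ m)).
- exact: measurable_law_support.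
- exact: measurable_itv.
- move=> x /=; rewrite in_itv/= andbT => x0x; apply: cdf_dom_support => //.
  rewrite (lt_le_trans _ (rcdf_nondecreasing X x0x)); last lra.
  by rewrite lt_neqAle rcdf_le1 andbT; apply/eqP.
- exact: past_measurable.
- by move=> x; exact: powR_ge0.
- by apply: powR_gt0; lra.
- move=> x /=; rewrite in_itv/= andbT => /(@rcdf_nondecreasing _ _ _ _ X) x0x.
  by apply: ge0_ler_powR; rewrite ?nnegrE; (exact: ltW || lra).
- by rewrite lebesgue_measure_itv /= ?ltry ?ltNyr.
Qed.

(** Otherwise the support contains a half-line on which 1 - F exceeds 1/2. *)
Lemma residual_fin_reaches0 : residual_integral \is a fin_num -> exists x, F x = 0.
Proof.
move=> fin; apply: contrapT => /forallNP F0.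
have [x0 x0P] := @rcdf_lt_near0 _ _ _ P X 2^-1 ltac:(lra).
suff E : residual_integral = +oo%E by rewrite E in fin.
apply: (@integral_ge_cst_pinfty R S `]-oo, x0]%classic _ (2^-1 `^ m)).
- exact: measurable_law_support.
- exact: measurable_itv.
- move=> x /=; rewrite in_itv/= => xx0; apply: cdf_dom_support => //.
  rewrite (le_lt_trans (rcdf_nondecreasing X xx0)) ?andbT; last lra.
  by rewrite lt_neqAle rcdf_ge0 andbT eq_sym; apply/eqP.
- exact: residual_measurable.
- by move=> x; exact: powR_ge0.
- by apply: powR_gt0; lra.
- move=> x /=; rewrite in_itv/= => /(@rcdf_nondecreasing _ _ _ _ X) xx0.
  by apply: ge0_ler_powR; rewrite ?nnegrE; (exact: ltW || lra).
- by rewrite lebesgue_measure_itv /= ?ltry ?ltNyr.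
Qed.

Lemma eq_integrals_of_symmetric : symmetric_law X -> past_integral = residual_integral.
Proof.
move=> [c sym].
have sym' x : F (c *+ 2 - x) = 1 - F x.
  have := sym (c - x); rewrite subKr.
  have -> : c + (c - x) = c *+ 2 - x by ring.
  lra.
have symS : (fun x => c *+ 2 - x) @^-1` S = S.
  apply/seteqP; split=> x /= Sx e e0; have := Sx e e0.
    have -> : c *+ 2 - x - e = c *+ 2 - (x + e) by ring.
    have -> : c *+ 2 - x + e = c *+ 2 - (x - e) by ring.
    by rewrite !sym'; lra.
  have -> : c *+ 2 - x - e = c *+ 2 - (x + e) by ring.
  have -> : c *+ 2 - x + e = c *+ 2 - (x - e) by ring.
  by rewrite !sym'; lra.
rewrite /past_integral (@ge0_integral_reflect R (c *+ 2)).
- by rewrite symS; apply: eq_integral => x _; rewrite sym'.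
- exact: measurable_law_support.
- by apply/measurable_EFinP/measurable_funTS; exact: past_measurable.
- by move=> x _; rewrite lee_fin powR_ge0.
Qed.

End extropy.

(** * Reflecting the levels of the distribution function *)

Section reflection_of_levels.
Context d (T : measurableType d) (R : realType) (P : probability T R).
Context (X : {RV P >-> R}) (f : R -> R) (a b : R).
Let mu : {measure set (measurableTypeR R) -> \bar R} := @lebesgue_measure R.
Local Notation F := (rcdf X).
Local Notation S := (law_support X).
Hypothesis f_pdf : is_pdf X f.
Hypothesis F_inv : cdf_invertible X.
Hypothesis f_pos : {ae @lebesgue_measure R, forall x, S x -> 0 < f x}.
Hypothesis Fa : F a = 0.
Hypothesis Fb : F b = 1.
Hypothesis F_gta : forall x, a < x -> 0 < F x.
Hypothesis F_ltb : forall x, x < b -> F x < 1.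

Let F_le x y : x <= y -> F x <= F y.
Proof. exact: rcdf_nondecreasing. Qed.

Let ab : a < b.
Proof.
rewrite ltNge; apply/negP => /F_le; rewrite Fa Fb; lra.
Qed.

Lemma rcdf_left_of_support x : x <= a -> F x = 0.
Proof. by move=> /F_le; rewrite Fa => Fx; apply/le_anti; rewrite Fx rcdf_ge0. Qed.

Lemma rcdf_right_of_support x : b <= x -> F x = 1.
Proof. by move=> /F_le; rewrite Fb => Fx; apply/le_anti; rewrite Fx rcdf_le1. Qed.

Lemma rcdf_increasing x y : a <= x -> y <= b -> x < y -> F x < F y.
Proof.
move=> ax yb xy; rewrite lt_neqAle (F_le (ltW xy)) andbT; apply/eqP => E.
have Fy : 0 < F y by apply: F_gta; lra.
have Fx : F x < 1 by apply: F_ltb; lra.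
have : x = y by apply: F_inv => //; rewrite inE /cdf_dom/=; lra.
lra.
Qed.

Lemma rcdf_le_inv x y : x <= b -> a <= y -> F x <= F y -> x <= y.
Proof.
move=> xb ay Fxy; rewrite leNgt; apply/negP => /(rcdf_increasing ay xb); lra.
Qed.

Lemma rcdf_inj x y : a <= x <= b -> a <= y <= b -> F x = F y -> x = y.
Proof.
move=> /andP[ax xb] /andP[ay yb] E.
by apply/le_anti/andP; split; apply: rcdf_le_inv => //; rewrite E.
Qed.

Lemma law_supportE : S = `[a, b]%classic.
Proof.
apply/seteqP; split=> x /=; rewrite in_itv/=.
  move=> Sx; apply/andP; split; rewrite leNgt; apply/negP => xlt.
    have := Sx (a - x); rewrite subr_gt0 xlt subrKC Fa => /(_ isT).
    by rewrite ltNge rcdf_ge0.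
  have := Sx (x - b); rewrite subr_gt0 xlt subKr Fb => /(_ isT).
  by rewrite ltNge rcdf_le1.
move=> /andP[ax xb] e e0.
have [xa|xa] := leP (x - e) a.
  by rewrite (rcdf_left_of_support xa); apply: F_gta; lra.
have [bx|bx] := leP b (x + e).
  by rewrite (rcdf_right_of_support bx); apply: F_ltb; lra.
by apply: rcdf_increasing; lra.
Qed.

Lemma level_reflection_exists :
  exists psi : R -> R, forall x, a <= psi x <= b /\ F (psi x) = 1 - F x.
Proof.
suff /choice[psi psiP] : forall x, exists y, a <= y <= b /\ F y = 1 - F x.
  by exists psi.
move=> x; have F0 := @rcdf_ge0 _ _ _ _ X x; have F1 := @rcdf_le1 _ _ _ _ X x.
have [||y] := @IVT R F a b (1 - F x) (ltW ab).
- by apply: continuous_subspaceT; exact: rcdf_continuous f_pdf.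
- by rewrite Fa Fb; rewrite /Num.min /Num.max ltr01; lra.
by rewrite in_itv/= => yab Fy; exists y.
Qed.

Section level_reflection.
Context (psi : R -> R).
Hypothesis psi_ab : forall x, a <= psi x <= b.
Hypothesis F_psi : forall x, F (psi x) = 1 - F x.

Let psi_a x : a <= psi x. Proof. by case/andP: (psi_ab x). Qed.
Let psi_b x : psi x <= b. Proof. by case/andP: (psi_ab x). Qed.

Lemma level_reflection_nonincreasing : {homo psi : x y /~ x <= y}.
Proof.
move=> x y yx; apply: rcdf_le_inv => //.
by rewrite !F_psi lerD2l lerN2 F_le.
Qed.

Lemma level_reflection_involutive x : a <= x <= b -> psi (psi x) = x.
Proof. by move=> xab; apply: rcdf_inj => //; rewrite !F_psi subKr. Qed.

Lemma level_reflection_left_end : psi a = b.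
Proof. by apply: rcdf_inj => //; [rewrite lexx ltW|rewrite F_psi Fa Fb subr0]. Qed.

Lemma level_reflection_right_end : psi b = a.
Proof. by apply: rcdf_inj => //; [rewrite lexx ltW|rewrite F_psi Fa Fb subrr]. Qed.

Let psi_measurable :
  measurable_fun setT (psi : measurableTypeR R -> measurableTypeR R).
Proof.
by apply: nonincreasing_measurable => // x y; exact: level_reflection_nonincreasing.
Qed.

(** For a <= r < b, psi x > r means x < psi r, an event of probability
F (psi r) = 1 - F r. *)
Lemma level_reflection_preserves_rays r :
  distribution P X (psi @^-1` `]r, +oo[%classic) =
  distribution P X `]r, +oo[%classic.
Proof.
rewrite [RHS]distribution_itvoy.
have [ra|ar] := ltP r a.
  rewrite rcdf_left_of_support ?ltW// subr0.
  rewrite -[1%:E](probability_setT (distribution P X)).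
  congr (distribution P X _); apply/seteqP; split=> // x _ /=.
  by rewrite in_itv/= andbT (lt_le_trans ra).
have [br|rb] := leP b r.
  rewrite rcdf_right_of_support// subrr.
  transitivity (distribution P X set0); last by rewrite measure0.
  congr (distribution P X _); apply/seteqP; split=> // x /=.
  by rewrite in_itv/= andbT => /(le_lt_trans br); rewrite ltNge psi_b.
rewrite -F_psi -(distribution_itvNyo f_pdf); congr (distribution P X _).
have rab : a <= r <= b by rewrite ar ltW.
have psi_r : a < psi r.
  rewrite ltNge; apply/negP => /rcdf_left_of_support; rewrite F_psi.
  by have := F_ltb rb; lra.
apply/seteqP; split=> x /=; rewrite !in_itv/= ?andbT => lt_x; rewrite ltNge.
  apply/negP => le_x; have := level_reflection_nonincreasing le_x.
  by rewrite level_reflection_involutive ?rab// leNgt lt_x.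
apply/negP => le_x.
have := F_le le_x; rewrite F_psi.
have := F_psi r.
have [xa|ax] := leP x a.
  have := F_gta psi_r; have := rcdf_left_of_support xa; lra.
have := rcdf_increasing (ltW ax) (psi_b r) lt_x; lra.
Qed.

(** Rays generate the Borel sets and are stable under intersection. *)
Lemma level_reflection_preserves_law (A : set R) : measurable A ->
  law X (psi @^-1` A) = law X A.
Proof.
have U := @measure_unique _ R (measurableTypeR R) (@RGenOInfty.G R)
  (fun n => `]- n%:R, +oo[%classic) _ _ _ _
  (pushforward (law X) (psi : measurableTypeR R -> measurableTypeR R)) (law X).
apply: (U _ _ _ _ psi_measurable).
- exact: RGenOInfty.measurableE.
- move=> _ _ [x ->] [y ->]; exists (Num.max x y).
  by apply/seteqP; split=> z; rewrite /= !in_itv/= !andbT gt_max => /andP.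
- by move=> n; exists (- n%:R).
- apply/seteqP; split=> // x _; exists (Num.truncn (- x)).+1 => //=.
  by rewrite in_itv/= andbT ltrNl truncnS_gt.
- by move=> _ [r ->]; exact: level_reflection_preserves_rays.
- move=> n; rewrite ltey_eq fin_num_measure//.
  by rewrite -[X in measurable X]setTI; exact: psi_measurable.
Qed.

(** The preimage of ]psi y, psi x[ under psi lies in ]x, y[, and f is positive
almost everywhere on ]psi y, psi x[, an interval inside the support. *)
Lemma level_reflection_contracting x y : x <= y ->
  (forall t, x < t < y -> f t <= f (psi t)) -> psi x - psi y <= y - x.
Proof.
move=> xy f_le.
have [psi_le|psi_lt] := leP (psi x) (psi y); first lra.
have mB : measurable (`]psi y, psi x[%classic : set R) by exact: measurable_itv.
have sub : psi @^-1` `]psi y, psi x[%classic `<=` `]x, y[%classic.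
  move=> t /=; rewrite !in_itv/= => /andP[yt tx].
  by apply/andP; split; rewrite ltNge; apply/negP => /level_reflection_nonincreasing; lra.
case: (f_pdf) => mf f0 _.
have B_pos : {ae mu, forall t, `]psi y, psi x[%classic t -> 0 < f t}.
  case: f_pos => N [mN N0 posN]; exists N; split=> //.
  apply: subset_trans posN; apply: subsetC => t /= fpt.
  rewrite in_itv/= => /andP[yt tx]; apply: fpt; apply: cdf_dom_support => //.
  have := psi_a y; have := psi_b x => ? ?.
  by apply/andP; split; [apply: F_gta; lra|apply: F_ltb; lra].
have B_le t : `]psi y, psi x[%classic (psi t) -> f t <= f (psi t).
  by move=> /sub /=; rewrite in_itv/=; exact: f_le.
have expand := @lebesgue_le_preimage_of_law_preserving R f (law X) mf f0
  (law_density f_pdf) psi _ psi_measurable level_reflection_preserves_law mB B_pos B_le.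
have shrink : (mu (psi @^-1` `]psi y, psi x[%classic) <= mu `]x, y[%classic)%E.
  have mI : measurable (`]x, y[%classic : set (measurableTypeR R)).
    exact: measurable_itv.
  have mpB : measurable (psi @^-1` `]psi y, psi x[%classic : set (measurableTypeR R)).
    by rewrite -[X in measurable X]setTI; exact: (psi_measurable measurableT mB).
  by apply: le_measure; rewrite ?inE.
have := le_trans expand shrink.
rewrite [X in (X <= _)%E]lebesgue_measure_itv [X in (_ <= X)%E]lebesgue_measure_itv.
rewrite /= !lte_fin psi_lt; case: ltP => _; rewrite -!EFinB lee_fin//; lra.
Qed.

Lemma cdf_inv_rcdf x : a < x < b -> cdf_inv X (F x) = x.
Proof.
move=> /andP[ax xb]; rewrite /cdf_inv pinvKV//.
by rewrite inE /cdf_dom/= F_gta// F_ltb.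
Qed.

Lemma level_reflection_interior x : a < x < b -> a < psi x < b.
Proof.
move=> /andP[ax xb]; have F0 := F_gta ax; have F1 := F_ltb xb.
apply/andP; split; rewrite ltNge; apply/negP.
  by move/rcdf_left_of_support; rewrite F_psi; lra.
by move/rcdf_right_of_support; rewrite F_psi; lra.
Qed.

(** With f <= f o psi on the lower half, contraction on [a, x], whose end a has
image b, gives b - psi x <= x - a. The upper half follows since psi is an
involution exchanging the halves. The other alternative of the class reads
f <= f o psi on the upper half, and contraction on [x, b] gives the opposite
comparison. *)
Lemma class_C_cdf_reflection : class_C X f ->
  (forall x, a <= x <= b -> F x <= 1 - F (a + b - x)) \/
  (forall x, a <= x <= b -> 1 - F (a + b - x) <= F x).
Proof.
move=> [_ [H|H]].
  left.
  have lower x : a <= x <= b -> F x <= 2^-1 -> a + b - x <= psi x.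
    move=> /andP[ax xb] Fx; have := level_reflection_contracting ax; 
    rewrite level_reflection_left_end.
    suff f_le t : a < t < x -> f t <= f (psi t) by move=> /(_ f_le); lra.
    move=> /andP[at_ tx]; have tab : a < t < b by lra.
    have Ft : 0 < F t < 2^-1.
      by rewrite F_gta//= (lt_le_trans _ Fx)//; apply: rcdf_increasing; lra.
    have := H _ Ft; rewrite -F_psi !cdf_inv_rcdf//; exact: level_reflection_interior.
  move=> x xab; suff /F_le : a + b - x <= psi x by rewrite F_psi; lra.
  have [Fx|Fx] := leP (F x) 2^-1; first exact: lower.
  have := lower (psi x) (psi_ab x); rewrite F_psi level_reflection_involutive//; lra.
right.
have upper x : a <= x <= b -> 2^-1 <= F x -> psi x <= a + b - x.
  move=> /andP[ax xb] Fx; have := level_reflection_contracting xb; 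
  rewrite level_reflection_right_end.
  suff f_le t : x < t < b -> f t <= f (psi t) by move=> /(_ f_le); lra.
  move=> /andP[xt tb]; have tab : a < t < b by lra.
  have ptab := level_reflection_interior tab.
  have Ft : 0 < F (psi t) < 2^-1.
    rewrite F_gta/=; last by case/andP: ptab.
    have : F x < F t by apply: rcdf_increasing; lra.
    by rewrite F_psi; lra.
  have := H _ Ft; rewrite -F_psi !cdf_inv_rcdf// level_reflection_involutive//; lra.
move=> x xab; suff /F_le : psi x <= a + b - x by rewrite F_psi; lra.
have [Fx|Fx] := leP 2^-1 (F x); first exact: upper.
have := upper (psi x) (psi_ab x); rewrite F_psi level_reflection_involutive//; lra.
Qed.

End level_reflection.

(** After reflecting the residual integral about the middle of the support, two
ordered integrands have the same finite integral. *)
Lemma symmetric_of_eq_integrals (m : R) : 0 < m -> class_C X f ->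
  past_integral X m \is a fin_num ->
  past_integral X m = residual_integral X m -> symmetric_law X.
Proof.
move=> m0 F_C fin E.
have [psi psiP] := level_reflection_exists.
have F_cont := @rcdf_continuous _ _ _ _ _ _ f_pdf.
have h_cont : continuous (fun x => 1 - F (a + b - x)).
  move=> x; apply: cvgB; first exact: cvg_cst.
  apply: (@continuous_comp _ _ _ (fun x => a + b - x) F); last exact: F_cont.
  by apply: cvgB; [exact: cvg_cst|exact: cvg_id].
have F_nneg x : F x \in Num.nneg by rewrite nnegrE rcdf_ge0.
have h_nneg x : 1 - F (a + b - x) \in Num.nneg by rewrite nnegrE subr_ge0 rcdf_le1.
have resE : residual_integral X m =
    (\int[mu]_(x in `[a, b]) ((1 - F (a + b - x)) `^ m)%:E)%E.
  rewrite /residual_integral (@ge0_integral_reflect R (a + b)).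
  - congr (integral _ _ _); rewrite law_supportE; apply/seteqP.
    by split=> x /=; rewrite !in_itv/=; lra.
  - exact: measurable_law_support.
  - by apply/measurable_EFinP/measurable_funTS; exact: residual_measurable.
  - by move=> x _; rewrite lee_fin powR_ge0.
have pastE : past_integral X m = (\int[mu]_(x in `[a, b]) (F x `^ m)%:E)%E.
  by rewrite /past_integral law_supportE.
have mab : measurable (`[a, b]%classic : set R) by exact: measurable_itv.
have mF : measurable_fun `[a, b]%classic (fun x => F x `^ m).
  by apply: measurable_funTS; exact: past_measurable.
have mh : measurable_fun `[a, b]%classic (fun x => (1 - F (a + b - x)) `^ m).
  apply: measurable_funTS; apply: (measurableT_comp (@measurable_powR R m)).
  exact: continuous_measurable_fun.
have ae_eq : {ae mu, forall x, `[a, b]%classic x ->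
    F x `^ m = (1 - F (a + b - x)) `^ m}.
  have [le|le] := class_C_cdf_reflection
    (fun x => (psiP x).1) (fun x => (psiP x).2) F_C.
    apply: (@ae_eq_of_le_integral _ (measurableTypeR R) R mu _ _ _ mab mF mh).
    - move=> x; rewrite /= in_itv => xab; rewrite powR_ge0/=.
      by apply: ge0_ler_powR; [exact: ltW|exact: F_nneg|exact: h_nneg|exact: le].
    - by rewrite -pastE.
    - by rewrite -pastE -resE.
  suff : {ae mu, forall x, `[a, b]%classic x ->
      (1 - F (a + b - x)) `^ m = F x `^ m}.
    move=> [N [mN N0 sN]]; exists N; split; [exact: mN|exact: N0|].
    apply: subset_trans sN.
    apply: subsetC => x H xab.
    exact: esym (H xab).
  apply: (@ae_eq_of_le_integral _ (measurableTypeR R) R mu _ _ _ mab mh mF).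
  - move=> x; rewrite /= in_itv => xab; rewrite powR_ge0/=.
    by apply: ge0_ler_powR; [exact: ltW|exact: h_nneg|exact: F_nneg|exact: le].
  - by rewrite -resE -E.
  - by rewrite -pastE -resE.
have FE x : a <= x <= b -> F x = 1 - F (a + b - x).
  apply: (continuous_eq_of_ae ab F_cont h_cont).
  case: ae_eq => N [mN N0 sN]; exists N; split; [exact: mN|exact: N0|].
  apply: subset_trans sN.
  apply: subsetC => y /=; rewrite in_itv => H /H; exact: (powR_injective m0).
exists ((a + b) / 2) => x.
have -> : (a + b) / 2 + x = a + b - ((a + b) / 2 - x) by field.
move: ((a + b) / 2 - x) => y.
have [ya|ay] := leP y a.
  have yb : b <= a + b - y by lra.
  by rewrite (rcdf_left_of_support ya) (rcdf_right_of_support yb) add0r.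
have [yb|yb] := leP b y.
  have ya : a + b - y <= a by lra.
  by rewrite (rcdf_right_of_support yb) (rcdf_left_of_support ya) addr0.
have yab : a <= y <= b by rewrite !ltW.
by rewrite (FE y yab) subrK.
Qed.

End reflection_of_levels.

Theorem theorem2p3 (d : measure_display) (T : measurableType d) (R : realType)
    (P : probability T R) (X : {RV P >-> R}) (f : R -> R) (m : R)
    (f_pdf : is_pdf X f)
    (F_inv : cdf_invertible X)
    (f_pos : {ae @lebesgue_measure R, forall x, law_support X x -> 0 < f x})
    (F_C : class_C X f)
    (m_ge1 : 1 <= m)
    (extropy_fin : gen_cumulative_past_extropy X m \is a fin_num \/
                   gen_cumulative_residual_extropy X m \is a fin_num) :
  symmetric_law X <->
  gen_cumulative_past_extropy X m = gen_cumulative_residual_extropy X m.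
Proof.
have m_gt0 : 0 < m by lra.
split=> [sym|E].
  by apply/extropy_eqP; exact: eq_integrals_of_symmetric.
have past_fin : past_integral X m \is a fin_num.
  by rewrite past_integralE fin_numM//; case: extropy_fin => //; rewrite E.
have IE : past_integral X m = residual_integral X m.
  exact/extropy_eqP.
have res_fin : residual_integral X m \is a fin_num by rewrite -IE.
have [a [Fa F_gta]] := @rcdf_bottom _ _ _ _ _ _ f_pdf
  (@residual_fin_reaches0 _ _ _ _ _ _ F_inv m_gt0 res_fin).
have [b [Fb F_ltb]] := @rcdf_top _ _ _ _ _ _ f_pdf
  (@past_fin_reaches1 _ _ _ _ _ _ F_inv m_gt0 past_fin).
exact: (@symmetric_of_eq_integrals _ _ _ _ _ _ a b f_pdf F_inv f_pos
  Fa Fb F_gta F_ltb m).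
Qed.
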